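(* Let $B>0$, let $h>0$, and let $V$ be a bounded real-valued potential on $(-\infty,B]$ supported in $[0,B]$ (no positivity condition is assumed). Then for any two bound states $0<k_1<k_2$ of $P(h)=-h^2\partial_x^2+V(x)$, the interval $(k_1,k_2)$ contains at least one antibound state. In particular, if there are $n\geq 1$ bound states in some subinterval of $(0,\infty)$, then there are at least $n-1$ antibound states in the same subinterval.
   Context: For $h>0$, let $P(h)=-h^2\partial_x^2+V(x)$ on the half-line $(-\infty,B]$ with the Neumann boundary condition $u_x(B)=0$. It is self-adjoint on $L^2(-\infty,B)$, and its resolvent $R_V(\lambda)=(P(h)-\lambda^2)^{-1}$, $\operatorname{Im}\lambda>0$, extends meromorphically to $\lambda\in\mathbb{C}$ as an operator $L^2_{\mathrm{comp}}\to H^2_{\mathrm{loc}}$. The poles are called resonances; $\lambda$ is a resonance when there is a nonzero $u\in H^2_{\mathrm{loc}}(-\infty,B)$ with $(P(h)-\lambda^2)u=0$, $u_x(B)=0$, and $u(x)=\alpha e^{-i\lambda x/h}$ for all $x<0$ and some constant $\alpha$. A positive number $k$ is a bound state if $ik$ is a pole of $R_V$, and an antibound state if $-ik$ is a pole of $R_V$. Equivalently, $k>0$ is a bound state (respectively, an antibound state) if and only if there is a nonzero solution $u\in H^2(0,B)$ of $(P(h)+k^2)u=0$ on $[0,B]$ with $u_x(B)=0$ and $hu_x(0)-ku(0)=0$ (respectively, $hu_x(0)+ku(0)=0$). *)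

(* Defs.v *)
From HB Require Import structures.
From mathcomp Require Import all_boot all_order all_algebra.
From mathcomp Require Import all_classical all_reals all_analysis.
From mathcomp Require Export complex.
Set Implicit Arguments.
Unset Strict Implicit.
Unset Printing Implicit Defensive.
Import Order.TTheory GRing.Theory Num.Theory.
Import numFieldNormedType.Exports.
Local Open Scope classical_set_scope.
Local Open Scope ring_scope.
Local Open Scope complex_scope.

Definition cexp (R : realType) (z : R[i]) : R[i] :=
  (expR (complex.Re z))%:C * (cos (complex.Im z) +i* sin (complex.Im z)).

(* All functions below live on the half-line ]-oo, B]: they are total functions
   on R whose values beyond B are irrelevant.  "Local" means on every compact
   [a, B], that is, up to and including the end point B. *)
Definition L2loc (R : realType) (B : R) (f : R -> R) : Prop :=
  forall a, a < B ->
    measurable_fun `[a, B] f /\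
    (@lebesgue_measure R).-integrable `[a, B] (fun x => (f x ^+ 2)%:E).

(* df is an integrable derivative of f: f is the primitive of df. *)
Definition primitive_on (R : realType) (B : R) (f df : R -> R) : Prop :=
  forall x y, x <= y -> y <= B ->
    f y - f x = \int[@lebesgue_measure R]_(t in `[x, y]) df t.

(* f belongs to H^2_loc, with f and f' = df taken as their continuous
   representatives and f'' = ddf in L^2_loc. *)
Definition H2loc (R : realType) (B : R) (f df ddf : R -> R) : Prop :=
  [/\ L2loc B f, L2loc B df, L2loc B ddf,
      primitive_on B f df & primitive_on B df ddf].

Definition H2locC (R : realType) (B : R) (u du ddu : R -> R[i]) : Prop :=
  H2loc B (fun x => complex.Re (u x)) (fun x => complex.Re (du x))
    (fun x => complex.Re (ddu x)) /\
  H2loc B (fun x => complex.Im (u x)) (fun x => complex.Im (du x))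
    (fun x => complex.Im (ddu x)).

(* A resonance is a pole of the continued resolvent, expressed by its outgoing
   resonant state u; the case Im lambda > 0 gives L^2 eigenfunctions. *)
Definition resonance (R : realType) (B h : R) (V : R -> R) (lambda : R[i]) :
    Prop :=
  exists u du ddu : R -> R[i],
    [/\ H2locC B u du ddu,
        exists2 x, x <= B & u x <> 0,
        {ae (@lebesgue_measure R), forall x, x <= B ->
          - (h ^+ 2)%:C * ddu x + (V x)%:C * u x - lambda ^+ 2 * u x = 0},
        du B = 0 &
        exists alpha : R[i], forall x, x < 0 ->
          u x = alpha * cexp ((0 -i* 1) * lambda * x%:C / h%:C)].

Definition bound_state (R : realType) (B h : R) (V : R -> R) (k : R) : Prop :=
  0 < k /\ resonance B h V (0 +i* k).

Definition antibound_state (R : realType) (B h : R) (V : R -> R) (k : R) :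
    Prop :=
  0 < k /\ resonance B h V (0 -i* k).

(* Main.v *)
Require Import Defs.
From mathcomp Require Import all_boot all_order all_algebra.
From mathcomp Require Import all_classical all_reals all_analysis.
From mathcomp Require Import measurable_realfun ring lra.
Set Implicit Arguments.
Unset Strict Implicit.
Unset Printing Implicit Defensive.
Import Order.TTheory GRing.Theory Num.Theory.
Import numFieldNormedType.Exports.
Local Open Scope classical_set_scope.
Local Open Scope ring_scope.

(* Let phi_k be the solution of h^2 phi'' = (V + k^2) phi on ]-oo, B] with
   phi_k(B) = 1, phi_k'(B) = 0, and put A(k) = phi_k(0), D(k) = phi_k'(0).  A
   bound state is a root of h D = k A and an antibound state a root of
   h D = - k A.  For s < t close to each other the Wronskian identity
   D(s) A(t) - A(s) D(t) = (t^2 - s^2) / h^2 * int_0^B phi_s phi_t > 0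
   shows that D / A is locally strictly decreasing.  Since h D / A equals k1
   at k1 and the larger value k2 at k2, it must pass through a pole in between,
   and on its way down to -oo it crosses -k.
   Since V is merely measurable, solutions are built by Picard iteration in the
   norm weighted by exp(mu (b - x)), in which the Volterra operator has norm at
   most 1/2. *)

(** The integral of [phi_s phi_t] is positive only because it is close to that of [phi_s ^ 2]: as V
    has no sign, the solutions may oscillate, and for distant s and t nothing prevents a negative
    value. The proof therefore needs one step length d valid on all of [k1, k2], and this makes
    every estimate quantitative. The normalisation phi_k(B) = 1 and a Lipschitz bound in x keep
    phi_k at least 1/2 on a layer of fixed width at B, and phi_k is Lipschitz in k. A single
    weighted estimate supplies these bounds, uniqueness and continuity in k. The equation is used in
    integrated form: a solution and its derivative are tied by [primitive_on], and integrands are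
    kept bounded and measurable, a class which, unlike that of integrable functions, is closed under
    products. Bound and antibound states are the conditions h phi'(0) = kappa phi(0) with kappa = k
    and kappa = - k on the same phi_k, since the equation contains only kappa ^ 2. *)

Local Notation integ a b f := (\int[@lebesgue_measure _]_(t in `[a, b]) f t).

(** * Calculus of bounded measurable functions on a segment *)

Definition bmeas (R : realType) (a b : R) (f : R -> R) : Prop :=
  measurable_fun `[a, b] f /\
  exists M, forall t, a <= t -> t <= b -> `|f t| <= M.

Section BoundedMeasurable.
Context {R : realType}.
Implicit Types (a b c x y t k C M : R) (f g F : R -> R).

Lemma bmeas_cst a b k : bmeas a b (fun=> k).
Proof. by split; [exact: measurable_cst|exists `|k|]. Qed.

Lemma bmeasS a b x y f : a <= x -> y <= b -> bmeas a b f -> bmeas x y f.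
Proof.
move=> ax yb [mf [M fM]]; split.
  apply: measurable_funS mf => //; apply: subset_itv; rewrite bnd_simp//.
by exists M => t xt ty; apply: fM; [exact: le_trans xt|exact: le_trans yb].
Qed.

Lemma eq_bmeas a b f g : (forall t, a <= t -> t <= b -> f t = g t) ->
  bmeas a b f -> bmeas a b g.
Proof.
move=> fg [mf [M fM]]; split.
  apply: eq_measurable_fun mf => t; rewrite inE/= in_itv/= => /andP[]; exact: fg.
by exists M => t at_ tb; rewrite -fg//; exact: fM.
Qed.

Lemma bmeasD a b f g :
  bmeas a b f -> bmeas a b g -> bmeas a b (fun t => f t + g t).
Proof.
move=> [mf [M fM]] [mg [N gN]]; split; first exact: measurable_funD.
exists (M + N) => t at_ tb; apply: le_trans (ler_normD _ _) _.
by apply: lerD; [exact: fM|exact: gN].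
Qed.

Lemma bmeasM a b f g :
  bmeas a b f -> bmeas a b g -> bmeas a b (fun t => f t * g t).
Proof.
move=> [mf [M fM]] [mg [N gN]]; split; first exact: measurable_funM.
exists (M * N) => t at_ tb; rewrite normrM.
by apply: ler_pM => //; [exact: fM|exact: gN].
Qed.

Lemma bmeasZ a b k f : bmeas a b f -> bmeas a b (fun t => k * f t).
Proof. by apply: bmeasM; exact: bmeas_cst. Qed.

Lemma bmeasB a b f g :
  bmeas a b f -> bmeas a b g -> bmeas a b (fun t => f t - g t).
Proof.
move=> bf bg; have := bmeasD bf (bmeasZ (-1) bg).
by apply: eq_bmeas => t _ _; rewrite mulN1r.
Qed.

Lemma bmeas_integrable a b f : bmeas a b f ->
  (@lebesgue_measure R).-integrable `[a, b] (EFin \o f).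
Proof.
move=> [mf [M fM]]; apply: measurable_bounded_integrable => //.
  by rewrite /= lebesgue_measure_itv/=; case: ifP => // _; rewrite -EFinB ltry.
exists M; split; first exact: num_real.
move=> N MN t /=; rewrite in_itv/= => /andP[at_ tb].
exact: le_trans (fM _ at_ tb) (ltW MN).
Qed.

Lemma eq_integ a b f g : (forall t, a <= t -> t <= b -> f t = g t) ->
  integ a b f = integ a b g.
Proof.
move=> fg; apply: eq_Rintegral => t; rewrite inE/= in_itv/= => /andP[]; exact: fg.
Qed.

Lemma integ_pt a f : integ a a f = 0.
Proof. by rewrite set_itv1 Rintegral_set1. Qed.

Lemma integD a b f g : bmeas a b f -> bmeas a b g ->
  integ a b (fun t => f t + g t) = integ a b f + integ a b g.
Proof. by move=> bf bg; rewrite RintegralD//; exact: bmeas_integrable. Qed.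

Lemma integB a b f g : bmeas a b f -> bmeas a b g ->
  integ a b (fun t => f t - g t) = integ a b f - integ a b g.
Proof. by move=> bf bg; rewrite RintegralB//; exact: bmeas_integrable. Qed.

Lemma integZ a b k f : bmeas a b f ->
  integ a b (fun t => k * f t) = k * integ a b f.
Proof. by move=> bf; rewrite RintegralZl//; exact: bmeas_integrable. Qed.

Lemma integ_cst a b k : a <= b -> integ a b (fun=> k) = k * (b - a).
Proof.
move=> ab; rewrite Rintegral_cst//= lebesgue_measure_itv/= lte_fin.
case: ltP => [//|ba]; have -> : a = b by apply/eqP; rewrite eq_le ab.
by rewrite subrr.
Qed.

Lemma integ_split_integrable a b x f : a <= x -> x <= b ->
  (@lebesgue_measure R).-integrable `[a, b] (EFin \o f) ->
  integ a b f = integ a x f + integ x b f.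
Proof.
move=> ax xb If; have sub : `]x, b] `<=` `[a, b].
  by apply: subset_itv; rewrite bnd_simp.
have := @Rintegral_itvB _ f (BLeft a) (BRight b) x If.
rewrite !bnd_simp => /(_ ax xb).
rewrite (Rintegral_itv_obnd_cbnd (r := x)); last exact: integrableS If.
by move=> <-; ring.
Qed.

Lemma integ_split a b x f : a <= x -> x <= b -> bmeas a b f ->
  integ a b f = integ a x f + integ x b f.
Proof. by move=> ax xb /bmeas_integrable; exact: integ_split_integrable. Qed.

Lemma le_integ a b f g : bmeas a b f -> bmeas a b g ->
  (forall t, a <= t -> t <= b -> f t <= g t) -> integ a b f <= integ a b g.
Proof.
move=> bf bg fg; apply: le_Rintegral => //; try exact: bmeas_integrable.
by move=> t /=; rewrite in_itv/= => /andP[]; exact: fg.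
Qed.

Lemma ler_norm_integ a b f g : bmeas a b f -> bmeas a b g ->
  (forall t, a <= t -> t <= b -> `|f t| <= g t) -> `|integ a b f| <= integ a b g.
Proof.
move=> bf bg fg; rewrite ler_norml; apply/andP; split.
  rewrite -mulN1r -integZ//; apply: le_integ => //; first exact: bmeasZ.
  move=> t at_ tb; rewrite mulN1r lerNl.
  by apply: le_trans (fg t at_ tb); rewrite -normrN ler_norm.
by apply: le_integ => // t at_ tb; exact: le_trans (ler_norm _) (fg t at_ tb).
Qed.

Lemma ler_norm_integ_cst a b f C : a <= b -> bmeas a b f ->
  (forall t, a <= t -> t <= b -> `|f t| <= C) -> `|integ a b f| <= C * (b - a).
Proof.
move=> ab bf fC; rewrite -integ_cst//.
by apply: ler_norm_integ => //; exact: bmeas_cst.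
Qed.

Lemma lipschitz_sym a b f C :
  (forall x y, a <= x -> x <= y -> y <= b -> `|f y - f x| <= C * (y - x)) ->
  forall x y, a <= x <= b -> a <= y <= b -> `|f y - f x| <= `|C| * `|y - x|.
Proof.
move=> fC.
have mono x y : a <= x -> x <= y -> y <= b -> `|f y - f x| <= `|C| * `|y - x|.
  move=> ax xy yb; apply: le_trans (fC _ _ ax xy yb) _.
  by rewrite (ger0_norm (x := y - x)) ?subr_ge0// ler_wpM2r ?subr_ge0// ler_norm.
move=> x y /andP[ax xb] /andP[ay yb].
by have [xy|/ltW yx] := leP x y; [|rewrite distrC (distrC y)]; exact: mono.
Qed.

Lemma lipschitz_within_continuous a b f C :
  (forall x y, a <= x -> x <= y -> y <= b -> `|f y - f x| <= C * (y - x)) ->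
  {within `[a, b], continuous f}.
Proof.
move=> /lipschitz_sym fC; apply/subspace_continuousP => x /=.
rewrite in_itv/= => xab; apply/cvgrPdist_le => e e0.
rewrite near_withinE; near=> y => yab; rewrite distrC.
apply: le_trans (fC x y xab _) _; first by move: yab; rewrite /= in_itv.
have C1 : 0 < `|C| + 1 by rewrite ltr_wpDl.
apply: (@le_trans _ _ ((`|C| + 1) * `|y - x|)).
  by rewrite ler_wpM2r// lerDl.
rewrite mulrC -ler_pdivlMr//; near: y; rewrite near_simpl.
have : x @[x --> x] --> x by [].
move=> /cvgrPdist_le /(_ (e / (`|C| + 1))); rewrite divr_gt0// => /(_ isT).
by apply: filterS => y; rewrite distrC.
Unshelve. all: by end_near. Qed.

Lemma lipschitz_bmeas a b f C :
  (forall x y, a <= x -> x <= y -> y <= b -> `|f y - f x| <= C * (y - x)) ->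
  bmeas a b f.
Proof.
move=> fC; split.
  apply: subspace_continuous_measurable_fun => //.
  exact: lipschitz_within_continuous fC.
exists (`|f a| + `|C| * `|b - a|) => t at_ tb.
have := lipschitz_sym fC (x := a) (y := t).
rewrite lexx (le_trans at_ tb) at_ tb => /(_ isT isT) h.
rewrite -(subrK (f a) (f t)) addrC; apply: le_trans (ler_normD _ _) _.
rewrite lerD2l; apply: le_trans h _; rewrite ler_wpM2l// !ger0_norm ?subr_ge0//.
  by rewrite lerD2r.
exact: le_trans tb.
Qed.

End BoundedMeasurable.

(** * Primitives of bounded measurable functions *)

Section Primitives.
Context {R : realType}.
Implicit Types (a b c x y t k C M : R) (f g F G q r : R -> R).

Lemma le0_archi x K : (forall n, x * n.+1%:R <= K) -> x <= 0.
Proof.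
move=> xK; rewrite leNgt; apply/negP => x0.
have K0 : 0 <= K by apply: le_trans (xK 0%N); rewrite mulr1 ltW.
have := xK (Num.truncn (K / x)); rewrite -ler_pdivlMl// leNgt mulrC.
by rewrite truncnS_gt ?divr_ge0 ?ltW.
Qed.

(** Over [n.+1] equal pieces the increments add up to at most [C * (b - a) ^+ 2 / n.+1%:R], for
    every [n]. This stands in for the mean value theorem, as the functions concerned are
    differentiable only almost everywhere. *)
Lemma quadratic_increment_cst a b C F : a <= b ->
  (forall x y, a <= x -> x <= y -> y <= b -> `|F y - F x| <= C * (y - x) ^+ 2) ->
  F b = F a.
Proof.
move=> ab FC; apply/eqP; rewrite -subr_eq0 -normr_le0.
apply: (@le0_archi _ (C * (b - a) ^+ 2)) => n.
set N : R := n.+1%:R; have N0 : 0 < N by rewrite ltr0n.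
pose d := (b - a) / N; have d0 : 0 <= d by rewrite divr_ge0 ?subr_ge0// ltW.
have Nd : N * d = b - a by rewrite mulrC divfK// gt_eqF.
have step i : (i <= n.+1)%N ->
    `|F (a + i%:R * d) - F a| <= i%:R * (C * d ^+ 2).
  elim: i => [|i IH] iN; first by rewrite !mul0r addr0 subrr normr0.
  have := FC (a + i%:R * d) (a + i.+1%:R * d).
  have -> : a + i.+1%:R * d - (a + i%:R * d) = d by rewrite -natr1; ring.
  have -> : (i.+1%:R * (C * d ^+ 2) : R) = C * d ^+ 2 + i%:R * (C * d ^+ 2).
    by rewrite -natr1; ring.
  move=> h; rewrite -(subrKA (F (a + i%:R * d))).
  apply: le_trans (ler_normD _ _) _; apply: lerD; last exact/IH/ltnW.
  apply: h; first by rewrite lerDl mulr_ge0.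
    by rewrite lerD2l ler_wpM2r// ler_nat.
  have -> : b = a + N * d by rewrite Nd; ring.
  by rewrite lerD2l ler_wpM2r// ler_nat.
have := step _ (leqnn _); rewrite -/N.
have -> : a + N * d = b by rewrite Nd; ring.
move=> h.
apply: le_trans (ler_wpM2r (ltW N0) h) _.
by rewrite le_eqVlt; apply/orP; left; apply/eqP; rewrite -Nd; ring.
Qed.

Lemma primitive_lipschitz a b F f M : bmeas a b f ->
  (forall t, a <= t -> t <= b -> `|f t| <= M) -> primitive_on b F f ->
  forall x y, a <= x -> x <= y -> y <= b -> `|F y - F x| <= M * (y - x).
Proof.
move=> bf fM pF x y ax xy yb; rewrite pF//; apply: ler_norm_integ_cst => //.
  exact: bmeasS bf.
by move=> t xt ty; apply: fM; [exact: le_trans xt|exact: le_trans yb].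
Qed.

Lemma primitive_bmeas a b F f : bmeas a b f -> primitive_on b F f -> bmeas a b F.
Proof.
move=> bf pF; case: (bf) => _ [M fM].
exact: lipschitz_bmeas (primitive_lipschitz bf fM pF).
Qed.

Lemma primitiveB b F f G g : (forall a, bmeas a b f) -> (forall a, bmeas a b g) ->
  primitive_on b F f -> primitive_on b G g ->
  primitive_on b (fun t => F t - G t) (fun t => f t - g t).
Proof.
move=> bf bg pF pG x y xy yb; rewrite integB -?pF -?pG//; try exact: bmeasS yb _.
by ring.
Qed.

Lemma primitiveZ b F f k : (forall a, bmeas a b f) -> primitive_on b F f ->
  primitive_on b (fun t => k * F t) (fun t => k * f t).
Proof.
move=> bf pF x y xy yb; rewrite integZ -?pF//; last exact: bmeasS yb _.
by ring.
Qed.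

Lemma eq_primitive b F f g : (forall t, t <= b -> f t = g t) ->
  primitive_on b F f -> primitive_on b F g.
Proof.
move=> fg pF x y xy yb; rewrite pF//; apply: eq_integ => t _ ty.
by apply: fg; exact: le_trans yb.
Qed.

Lemma primitive_le b b' F f : b' <= b -> primitive_on b F f -> primitive_on b' F f.
Proof. by move=> b'b pF x y xy yb; apply: pF => //; exact: le_trans b'b. Qed.

Lemma primitive_tail b f : (forall a, bmeas a b f) ->
  primitive_on b (fun x => - integ x b f) f.
Proof.
by move=> bf x y xy yb; rewrite [X in _ - - X](integ_split xy yb)//; ring.
Qed.

(** There is no pointwise product rule for primitives of merely measurable functions. Instead, the
    product minus the integral of its expected derivative has increments of second order, hence is
    constant. *)
Lemma integ_by_parts a b F f G g : a <= b -> bmeas a b f -> bmeas a b g ->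
  primitive_on b F f -> primitive_on b G g ->
  F b * G b - F a * G a = integ a b (fun t => f t * G t + F t * g t).
Proof.
move=> ab bf bg pF pG.
have bF := primitive_bmeas bf pF; have bG := primitive_bmeas bg pG.
have bfG : bmeas a b (fun t => f t * G t + F t * g t).
  by apply: bmeasD; exact: bmeasM.
case: (bf) => _ [M fM]; case: (bg) => _ [N gN].
have lF := primitive_lipschitz bf fM pF; have lG := primitive_lipschitz bg gN pG.
pose H x := F x * G x - integ a x (fun t => f t * G t + F t * g t).
suff : H b = H a by rewrite /H integ_pt; lra.
apply: (@quadratic_increment_cst a b (M * N + M * N)) => // x y ax xy yb.
have xb := le_trans xy yb; have ay := le_trans ax xy.
have sub h : bmeas a b h -> bmeas x y h by exact: bmeasS.
(* The increment of [F * G] over [[x, y]] is [G y] times the integral of [f] plus [F x] times that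
   of [g]. Subtracting the expected integrand leaves [k], in which each term has a factor of size
   O(y - x); integration gives the second such factor. *)
pose k t := f t * (G y - G t) + (F x - F t) * g t.
have bk : bmeas x y k.
  by apply: sub; apply: bmeasD; apply: bmeasM => //;
    apply: bmeasB => //; exact: bmeas_cst.
have -> : H y - H x = integ x y k.
  rewrite /H (integ_split (x := x) (b := y))//; last exact: bmeasS bfG.
  rewrite (@eq_integ _ x y k (fun t => G y * f t + F x * g t -
      (f t * G t + F t * g t))); last by move=> t _ _; rewrite /k; ring.
  rewrite integB; last 2 first.
    by apply: bmeasD; apply: bmeasZ; exact: sub.
    exact: sub.
  have -> : integ x y (fun t => G y * f t + F x * g t) =
      G y * integ x y f + F x * integ x y g.
    rewrite -!integZ; [|exact: sub|exact: sub].
    by rewrite -integD//; apply: bmeasZ; exact: sub.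
  by rewrite -pF// -pG//; ring.
have yx : 0 <= y - x by rewrite subr_ge0.
rewrite expr2 mulrA; apply: ler_norm_integ_cst => // t xt ty.
have at_ := le_trans ax xt; have tb := le_trans ty yb.
have fMt := fM t at_ tb; have gNt := gN t at_ tb.
have M0 := le_trans (normr_ge0 _) fMt; have N0 := le_trans (normr_ge0 _) gNt.
rewrite mulrDl; apply: le_trans (ler_normD _ _) _; apply: lerD; rewrite normrM.
  rewrite -mulrA; apply: ler_pM => //; apply: le_trans (lG _ _ at_ ty yb) _.
  by rewrite ler_wpM2l// lerD2l lerN2.
rewrite mulrAC; apply: ler_pM => //; rewrite distrC.
by apply: le_trans (lF _ _ ax xt tb) _; rewrite ler_wpM2l// lerD2r.
Qed.

Lemma bmeas_expR a b c k : bmeas a b (fun x => expR (c * (k - x))).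
Proof.
split.
  apply: (@measurableT_comp _ _ _ _ _ _ expR) => //.
  by apply: measurable_funM => //; exact: measurable_funB.
exists (expR (`|c| * (`|k| + `|a| + `|b|))) => t at_ tb.
rewrite ger0_norm ?expR_ge0// ler_expR; apply: le_trans (ler_norm _) _.
rewrite normrM ler_wpM2l//; apply: le_trans (ler_normB _ _) _.
rewrite -addrA lerD2l ler_norml; apply/andP; split.
  apply: le_trans at_; rewrite lerNl.
  by rewrite -(normrN a); apply: le_trans (ler_norm _) _; rewrite lerDl.
by apply: le_trans tb _; apply: le_trans (ler_norm _) _; rewrite lerDr.
Qed.

Lemma primitive_expR b c k :
  primitive_on b (fun x => expR (c * (k - x))) (fun x => - c * expR (c * (k - x))).
Proof.
move=> x y; rewrite le_eqVlt => /orP[/eqP <- _|xy yb].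
  by rewrite integ_pt subrr.
pose F t := expR (c * (k - t)).
have dF t : is_derive t 1 F (- c * F t).
  have dg : is_derive t 1 (fun s => c * (k - s)) (- c).
    by apply: is_derive_eq; rewrite add0r mul1r scalerN; congr (- _); exact: mulr1.
  rewrite /F mulrC; exact: (is_derive1_comp (is_derive_expR _) dg).
have cF : continuous F.
  by move=> t; apply: differentiable_continuous; apply/derivable1_diffP.
have cf : continuous (fun t => - c * F t).
  by move=> t; apply: cvgM; [exact: cvg_cst|exact: cF].
have := @continuous_FTC2 R (fun t => - c * F t) F x y xy.
rewrite /Rintegral => ->//.
- exact: continuous_subspaceT.
- split; first by move=> t _; exact: ex_derive.
  + exact/cvg_at_right_filter/cF.
  + exact/cvg_at_left_filter/cF.
- by move=> t _; rewrite derive1E; exact: derive_val.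
Qed.
End Primitives.

(** * A priori estimate for f'' = q f + r *)

Section Apriori.
Context {R : realType}.
Implicit Types (a b c x y t k C D M mu : R) (f q r : R -> R).

Lemma weight_ge1 b mu x : 0 < mu -> x <= b -> 1 <= expR (mu * (b - x)).
Proof. by move=> mu0 xb; rewrite -expR0 ler_expR mulr_ge0 ?subr_ge0// ltW. Qed.

(** Each integration up to [b] gains a factor [1 / mu]: the weight integrates to
    [(expR (mu * (b - x)) - 1) / mu], and the [- 1] is dropped. Two integrations therefore turn a
    potential of size [M] into the factor [M / mu / mu]. *)
Lemma ler_tail_weight a b mu C f : 0 < mu -> 0 <= C -> bmeas a b f ->
  (forall t, a <= t -> t <= b -> `|f t| <= C * expR (mu * (b - t))) ->
  forall x, a <= x -> x <= b ->
    `|integ x b f| <= C / mu * expR (mu * (b - x)).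
Proof.
move=> mu0 C0 bf fC x ax xb.
have bw : bmeas x b (fun t => expR (mu * (b - t))) by exact: bmeas_expR.
apply: (@le_trans _ _ (integ x b (fun t => C * expR (mu * (b - t))))).
  apply: ler_norm_integ => //; [exact: bmeasS bf|exact: bmeasZ|].
  by move=> t xt tb; apply: fC => //; exact: le_trans xt.
rewrite integZ// -mulrA ler_wpM2l// ler_pdivlMl//.
have := @primitive_expR R b mu b x b xb (lexx b).
rewrite integZ// subrr mulr0 expR0 => h.
suff : mu * integ x b (fun t => expR (mu * (b - t))) = expR (mu * (b - x)) - 1.
  by move=> ->; rewrite lerBlDr lerDl.
by rewrite -[LHS]opprK -mulNr -h opprB.
Qed.

Lemma apriori_step a b mu M D D0 C f f1 q r : 0 < mu -> 0 <= D -> 0 <= C ->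
  bmeas a b f -> bmeas a b q -> bmeas a b r ->
  (forall t, a <= t -> t <= b -> `|q t| <= M) ->
  (forall t, a <= t -> t <= b -> `|r t| <= D * expR (mu * (b - t))) ->
  primitive_on b f f1 -> primitive_on b f1 (fun t => q t * f t + r t) ->
  `|f b| <= D0 -> f1 b = 0 ->
  (forall t, a <= t -> t <= b -> `|f t| <= C * expR (mu * (b - t))) ->
  forall t, a <= t -> t <= b ->
    `|f1 t| <= (M * C + D) / mu * expR (mu * (b - t)) /\
    `|f t| <= (D0 + (M * C + D) / mu / mu) * expR (mu * (b - t)).
Proof.
move=> mu0 D_0 C0 bf bq br qM rD pf pf1 fb f1b fC.
have bqf : bmeas a b (fun t => q t * f t + r t).
  by apply: bmeasD => //; exact: bmeasM.
have bf1 : bmeas a b f1 by exact: primitive_bmeas bqf pf1.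
suff f1C t : a <= t -> t <= b ->
    0 <= M * C + D /\ `|f1 t| <= (M * C + D) / mu * expR (mu * (b - t)).
  move=> t at_ tb; have [MCD f1t] := f1C t at_ tb; split => //.
  have := pf t b tb (lexx b).
  rewrite mulrDl => /eqP; rewrite subr_eq addrC -subr_eq => /eqP <-.
  apply: le_trans (ler_normB _ _) _; apply: lerD.
    apply: (le_trans fb); rewrite ler_peMr ?weight_ge1//.
    exact: le_trans fb.
  apply: (ler_tail_weight (a := a)) => //; first by rewrite divr_ge0// ltW.
  by move=> s as_ sb; case: (f1C s).
move=> at_ tb.
have M0 : 0 <= M by exact: le_trans (qM _ at_ tb).
have MCD : 0 <= M * C + D by rewrite addr_ge0// mulr_ge0.
split => //; have := pf1 t b tb (lexx b).
rewrite f1b sub0r => /eqP; rewrite eqr_oppLR => /eqP ->; rewrite normrN.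
apply: (ler_tail_weight (a := a)) => // s as_ sb.
apply: le_trans (ler_normD _ _) _; rewrite mulrDl; apply: lerD; last exact: rD.
by rewrite normrM -mulrA; apply: ler_pM => //; [exact: qM|exact: fC].
Qed.

(* Iterating the Volterra estimate contracts any initial bound by a factor 1/2
   at each step, whence a bound depending on the data only. *)
Lemma apriori a b mu M D D0 f f1 q r :
  0 < mu -> M / mu / mu <= 2^-1 -> 0 <= D ->
  bmeas a b f -> bmeas a b q -> bmeas a b r ->
  (forall t, a <= t -> t <= b -> `|q t| <= M) ->
  (forall t, a <= t -> t <= b -> `|r t| <= D * expR (mu * (b - t))) ->
  primitive_on b f f1 -> primitive_on b f1 (fun t => q t * f t + r t) ->
  `|f b| <= D0 -> f1 b = 0 ->
  forall t, a <= t -> t <= b ->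
    `|f t| <= 2 * (D0 + D / mu / mu) * expR (mu * (b - t)).
Proof.
move=> mu0 Mmu D_0 bf bq br qM rD pf pf1 fb f1b.
have D00 : 0 <= D0 by exact: le_trans fb.
set E := D0 + D / mu / mu.
have E0 : 0 <= E by rewrite addr_ge0// !divr_ge0// ltW.
have [C C0 fC] : exists2 C, 0 <= C &
    forall t, a <= t -> t <= b -> `|f t| <= C * expR (mu * (b - t)).
  case: (bf) => _ [C fC]; exists `|C| => // t at_ tb.
  apply: le_trans (fC t at_ tb) _; apply: le_trans (ler_norm _) _.
  by rewrite ler_peMr// weight_ge1.
have it n t : a <= t -> t <= b ->
    `|f t| <= (C / 2 ^+ n + 2 * E) * expR (mu * (b - t)).
  elim: n t => [|n IH] t at_ tb.
    apply: le_trans (fC t at_ tb) _; rewrite expr0 divr1 ler_wpM2r ?expR_ge0//.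
    by rewrite lerDl mulr_ge0.
  have Cn0 : 0 <= C / 2 ^+ n + 2 * E.
    by rewrite addr_ge0 ?mulr_ge0// invr_ge0 exprn_ge0.
  have [_ h] := apriori_step mu0 D_0 Cn0 bf bq br qM rD pf pf1 fb f1b IH at_ tb.
  apply: le_trans h _; rewrite ler_wpM2r ?expR_ge0//.
  have -> : D0 + (M * (C / 2 ^+ n + 2 * E) + D) / mu / mu =
      M / mu / mu * (C / 2 ^+ n + 2 * E) + E.
    by rewrite /E; field; rewrite ?gt_eqF//= ?expf_neq0.
  have := ler_wpM2r Cn0 Mmu; rewrite exprS invfM => h2.
  have -> : C * (2^-1 * (2 ^+ n)^-1) = 2^-1 * (C / 2 ^+ n) by ring.
  lra.
(* The excess of [f] over the claimed bound is at most [C * expR (mu * (b - t)) / 2 ^+ n] for all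
   [n]. As [n < 2 ^ n], the Archimedean criterion applies and no limit is taken. *)
move=> t at_ tb; rewrite -subr_le0.
apply: (@le0_archi _ _ (C * expR (mu * (b - t)))) => n.
have [x_le0|x_gt0] := leP (`|f t| - 2 * E * expR (mu * (b - t))) 0.
  apply: (@le_trans _ _ 0); last by rewrite mulr_ge0 ?expR_ge0.
  by rewrite mulr_le0_ge0.
apply: (@le_trans _ _ ((`|f t| - 2 * E * expR (mu * (b - t))) * 2 ^+ n)).
  by rewrite ler_wpM2l ?(ltW x_gt0)// -natrX ler_nat ltn_expl.
rewrite -ler_pdivlMr ?exprn_gt0// lerBlDr; apply: le_trans (it n t at_ tb) _.
by rewrite mulrDl mulrAC.
Qed.

End Apriori.

(** * Existence by Picard iteration *)

Section Picard.
Context {R : realType} (b M mu : R) (q : R -> R).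
Hypotheses (bq : forall a, bmeas a b q) (qM : forall t, t <= b -> `|q t| <= M).
Hypotheses (mu0 : 0 < mu) (Mmu : M / mu / mu <= 2^-1).

Let w x := expR (mu * (b - x)).

(** [picard g] is the solution of u'' = q g with u(b) = u'(b) = 0, and [picard1 g] is its
    derivative. A fixed point of [1 + picard] thus solves u'' = q u with u(b) = 1 and u'(b) = 0. *)
Definition picard1 (g : R -> R) x : R := - integ x b (fun t => q t * g t).

Definition picard (g : R -> R) x : R := - integ x b (picard1 g).

Definition picard_term n := iter n picard (fun=> 1).

Definition picard_sum n x := \sum_(i < n) picard_term i x.

Let bqg g : (forall a, bmeas a b g) -> forall a, bmeas a b (fun t => q t * g t).
Proof. by move=> bg a; exact: bmeasM. Qed.

Lemma picard1_bmeas g : (forall a, bmeas a b g) -> forall a, bmeas a b (picard1 g).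
Proof.
move=> bg a; apply: (primitive_bmeas (bqg bg a)).
exact: primitive_tail (bqg bg).
Qed.

Lemma picard_bmeas g : (forall a, bmeas a b g) -> forall a, bmeas a b (picard g).
Proof.
move=> bg a; apply: (primitive_bmeas (picard1_bmeas bg a)).
exact: primitive_tail (picard1_bmeas bg).
Qed.

Lemma picardB g g' x : (forall a, bmeas a b g) -> (forall a, bmeas a b g') ->
  x <= b -> picard (fun t => g t - g' t) x = picard g x - picard g' x.
Proof.
move=> bg bg' xb; rewrite /picard -opprD -integB; try exact: picard1_bmeas.
congr (- _); apply: eq_integ => t _ tb; rewrite /picard1 -opprD -integB; try exact: bqg.
by congr (- _); apply: eq_integ => s _ _; rewrite mulrBr.
Qed.

Lemma picard_le C g : 0 <= C -> (forall a, bmeas a b g) ->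
  (forall t, t <= b -> `|g t| <= C * w t) ->
  forall t, t <= b -> `|picard g t| <= C / 2 * w t.
Proof.
move=> C0 bg gC t tb.
have M0 : 0 <= M by exact: le_trans (qM (lexx b)).
have h1 s : s <= b -> `|picard1 g s| <= M * C / mu * w s.
  move=> sb; rewrite normrN.
  apply: (ler_tail_weight (a := s)) => //; first exact: mulr_ge0.
    exact: bqg.
  move=> r sr rb; rewrite normrM -mulrA.
  by apply: ler_pM => //; [exact: qM|exact: gC].
apply: (@le_trans _ _ (M * C / mu / mu * w t)).
  rewrite normrN; apply: (ler_tail_weight (a := t)) => //.
  - by rewrite divr_ge0 ?mulr_ge0// ltW.
  - exact: picard1_bmeas.
  - by move=> s ts; exact: h1.
rewrite ler_wpM2r ?expR_ge0//.
have -> : M * C / mu / mu = C * (M / mu / mu) by ring.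
exact: ler_wpM2l.
Qed.

Lemma picard_term_bmeas n a : bmeas a b (picard_term n).
Proof.
elim: n a => [|n IH] a; first exact: bmeas_cst.
by rewrite /picard_term iterS; exact: picard_bmeas.
Qed.

Lemma picard_term_le n t : t <= b -> `|picard_term n t| <= 2^-1 ^+ n * w t.
Proof.
elim: n t => [|n IH] t tb.
  by rewrite /picard_term/= expr0 mul1r normr1 weight_ge1.
rewrite /picard_term iterS exprSr.
by apply: picard_le => // a; exact: picard_term_bmeas.
Qed.

Lemma picard_sumS n x : picard_sum n.+1 x = picard_sum n x + picard_term n x.
Proof. by rewrite /picard_sum big_ord_recr. Qed.

Lemma picard_sum_bmeas n a : bmeas a b (picard_sum n).
Proof.
elim: n a => [|n IH] a.
  have -> : picard_sum 0 = fun=> 0 by apply/funext => x; rewrite /picard_sum big_ord0.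
  exact: bmeas_cst.
have -> : picard_sum n.+1 = fun x => picard_sum n x + picard_term n x.
  by apply/funext => x; rewrite picard_sumS.
apply: bmeasD => //; exact: picard_term_bmeas.
Qed.

Lemma picard_sum_rec n x : x <= b ->
  picard_sum n.+1 x = 1 + picard (picard_sum n) x.
Proof.
move=> xb; elim: n => [|n IH].
  rewrite picard_sumS /picard_sum big_ord0 add0r /picard_term/= /picard.
  rewrite (@eq_integ _ _ _ _ (fun=> 0)); last first.
    move=> t _ tb; rewrite /picard1 (@eq_integ _ _ _ _ (fun=> 0)).
      by rewrite integ_cst// mul0r oppr0.
    by move=> s _ _; rewrite big_ord0 mulr0.
  by rewrite integ_cst// mul0r oppr0 addr0.
rewrite picard_sumS IH -addrA; congr (_ + _).
rewrite /picard_term iterS -/(picard_term n).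
have -> : picard_term n = fun t => picard_sum n.+1 t - picard_sum n t.
  by apply/funext => t; rewrite picard_sumS addrC addKr.
rewrite picardB//; try exact: picard_sum_bmeas.
by rewrite addrC subrK.
Qed.

(** The exact geometric sum is kept on the right so that the induction on [k] closes: adding the
    term of index [n + k] uses up exactly the difference of two consecutive bounds. *)
Lemma picard_sum_dist n k t : t <= b ->
  `|picard_sum (n + k) t - picard_sum n t| <=
    2 * (2^-1 ^+ n - 2^-1 ^+ (n + k)) * w t.
Proof.
move=> tb; elim: k => [|k IH]; first by rewrite addn0 !subrr mulr0 mul0r normr0.
rewrite addnS picard_sumS addrAC; apply: le_trans (ler_normD _ _) _.
have := picard_term_le (n + k) tb; rewrite exprS.
have := expR_ge0 (mu * (b - t)); rewrite -/(w t).
by lra.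
Qed.

Lemma picard_sum_cvg t : t <= b ->
  picard_sum n t @[n --> \oo] --> limn (picard_sum ^~ t).
Proof.
move=> tb.
have -> : picard_sum ^~ t = series (picard_term ^~ t).
  by apply/funext => n; rewrite /picard_sum /series/= big_mkord.
apply: (@normed_cvg R); apply: (@series_le_cvg _ _ (geometric (w t) 2^-1)).
- by move=> n /=.
- by move=> n /=; rewrite mulr_ge0 ?expR_ge0// exprn_ge0// invr_ge0.
- by move=> n /=; rewrite mulrC; exact: picard_term_le.
- apply: is_cvg_geometric_series; rewrite ger0_norm; lra.
Qed.

Definition picard_lim t := limn (picard_sum ^~ t).

Lemma picard_lim_dist n t : t <= b ->
  `|picard_lim t - picard_sum n t| <= 2 * 2^-1 ^+ n * w t.
Proof.
move=> tb; apply/ler_addgt0Pr => e e0.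
have /cvgrPdist_le /(_ e e0)[N _ NP] := picard_sum_cvg tb.
rewrite -(subrKA (picard_sum (n + N) t)); apply: le_trans (ler_normD _ _) _.
rewrite addrC; apply: lerD; last by apply: NP; rewrite /= leq_addl.
apply: le_trans (picard_sum_dist _ _ tb) _.
rewrite ler_wpM2r ?expR_ge0// ler_pM2l// lerBlDr lerDl.
by rewrite exprn_ge0// invr_ge0.
Qed.

Lemma picard_lim_bmeas a : bmeas a b picard_lim.
Proof.
split.
  apply: (@measurable_fun_cvg _ _ _ _ (fun n x => picard_sum n x)).
    by move=> n; case: (picard_sum_bmeas n a).
  by move=> t /=; rewrite in_itv/= => /andP[_ tb]; exact: picard_sum_cvg.
have [_ [C wC]] := bmeas_expR a b mu b.
exists (2 * C) => t at_ tb; have := picard_lim_dist 0 tb.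
rewrite /picard_sum big_ord0 subr0 expr0 mulr1 => h; apply: (le_trans h).
by rewrite ler_pM2l//; apply: le_trans (ler_norm _) _; exact: wC.
Qed.

(** No limit passes under the integral. In the weighted norm both sides lie within [2^-1 ^+ n] of
    [picard_sum n.+1]: the left one by the convergence rate, the right one because [picard] halves
    the distance from [picard_lim] to [picard_sum n]. *)
Lemma picard_lim_fixed t : t <= b -> picard_lim t = 1 + picard picard_lim t.
Proof.
move=> tb; apply/eqP; rewrite -subr_eq0 -normr_le0.
apply: (@le0_archi _ _ (2 * w t)) => n.
have : `|picard_lim t - (1 + picard picard_lim t)| <= 2 * 2^-1 ^+ n * w t.
  rewrite -(subrKA (picard_sum n.+1 t)); apply: le_trans (ler_normD _ _) _.
  have := picard_lim_dist n.+1 tb.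
  have : `|picard (fun s => picard_lim s - picard_sum n s) t| <=
      2 * 2^-1 ^+ n / 2 * w t.
    apply: picard_le => //.
      by move=> a; apply: bmeasB; [exact: picard_lim_bmeas|exact: picard_sum_bmeas].
    by move=> s sb; exact: picard_lim_dist.
  rewrite picardB//; [|exact: picard_lim_bmeas|exact: picard_sum_bmeas].
  rewrite picard_sum_rec// exprS.
  have -> : 1 + picard (picard_sum n) t - (1 + picard picard_lim t) =
      - (picard picard_lim t - picard (picard_sum n) t) by ring.
  by rewrite normrN; lra.
move=> h; apply: (@le_trans _ _ (2 * 2^-1 ^+ n * w t * 2 ^+ n)).
  apply: ler_pM => //.
  by rewrite -natrX ler_nat ltn_expl.
by rewrite exprVn mulrAC mulfVK ?expf_neq0.
Qed.

End Picard.

Lemma neumann_solution_exists (R : realType) (b M : R) (q : R -> R) :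
  (forall a, bmeas a b q) -> (forall t, t <= b -> `|q t| <= M) ->
  exists f df : R -> R, [/\ forall a, bmeas a b f, primitive_on b f df,
    primitive_on b df (fun t => q t * f t), f b = 1 & df b = 0].
Proof.
move=> bq qM.
have M0 : 0 <= M by exact: le_trans (qM _ (lexx b)).
pose mu : R := 2 * (M + 1); have mu0 : 0 < mu by rewrite /mu; lra.
have Mmu : M / mu / mu <= 2^-1.
  by rewrite !ler_pdivrMr// /mu; nra.
pose f := picard_lim b q.
have bf a : bmeas a b f by exact: (picard_lim_bmeas bq qM mu0 Mmu).
have fE t : t <= b -> f t = 1 + picard b q f t.
  exact: (picard_lim_fixed bq qM mu0 Mmu).
have bf1 a := picard1_bmeas bq bf a.
exists f, (picard1 b q f); split => //.
- move=> x y xy yb; rewrite !fE//; last exact: le_trans yb.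
  rewrite opprD addrACA subrr add0r; exact: (primitive_tail bf1).
- by apply: primitive_tail => a; exact: bmeasM.
- by rewrite fE// /picard integ_pt oppr0 addr0.
- by rewrite /picard1 integ_pt oppr0.
Qed.

(** * Crossing of Robin boundary conditions *)

Section Crossing.
Context {R : realType}.
Implicit Types (A D : R -> R) (h k d : R).

(** Arguing by contradiction avoids locating a pole of D / A. Without a root, [h * D k + k * A k]
    keeps the positive sign it has at [k1]; this keeps [A] from vanishing, so h D / A never rises
    above its initial value [k1], against its value [k2] at [k2]. All quotients are cleared. *)
Lemma robin_crossing_pos h k1 k2 d A D : 0 < h -> 0 < k1 -> k1 < k2 -> 0 < d ->
  {within `[k1, k2], continuous A} -> {within `[k1, k2], continuous D} ->
  (forall s t, k1 <= s -> s < t -> t <= k2 -> t - s < d ->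
    0 < D s * A t - A s * D t) ->
  h * D k1 = k1 * A k1 -> h * D k2 = k2 * A k2 -> 0 < A k1 ->
  exists2 k, k \in `]k1, k2[ & h * D k + k * A k = 0.
Proof.
move=> h0 k10 k12 d0 cA cD W E1 E2 A1; apply: contrapT => noroot.
pose F k := h * D k + k * A k.
have cF : {within `[k1, k2], continuous F}.
  move=> x; apply: cvgD; apply: cvgM; [exact: cvg_cst|exact: cD| |exact: cA].
  by apply: (@continuous_subspaceT _ _ _ id) => y; exact: cvg_id.
(* If [A k2] were 0, the boundary condition would give [D k2 = 0], and every Wronskian with [k2]
   would vanish. The maximum with [k1] provides a partner below [k2] that is closer than [d] and
   still in the interval. *)
have A2 : A k2 != 0.
  apply/eqP => A20; move: E2; rewrite A20 mulr0 => /eqP.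
  rewrite mulf_eq0 gt_eqF//= => /eqP D20.
  suff : 0 < D (Num.max k1 (k2 - d / 2)) * A k2 - A (Num.max k1 (k2 - d / 2)) * D k2.
    by rewrite A20 D20 !mulr0 subrr ltxx.
  apply: W => //; first by rewrite le_max lexx.
    by rewrite gt_max k12/=; lra.
  by rewrite ltrBlDr -ltrBlDl lt_max; apply/orP; right; lra.
have F_neq0 c : k1 <= c -> c <= k2 -> F c <> 0.
  rewrite le_eqVlt => /orP[/eqP <- _|k1c].
    by rewrite /F E1; have := mulr_gt0 k10 A1; lra.
  rewrite le_eqVlt => /orP[/eqP ->|ck2 Fc].
    rewrite /F E2 => /eqP; rewrite -mulr2n mulrn_eq0/= mulf_eq0 (negbTE A2) orbF.
    by rewrite gt_eqF//; lra.
  by apply: noroot; exists c => //; rewrite in_itv/= k1c.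
have F1 : 0 < F k1 by rewrite /F E1; have := mulr_gt0 k10 A1; lra.
have F_gt0 t : k1 <= t -> t <= k2 -> 0 < F t.
  move=> k1t tk2; rewrite ltNge; apply/negP => Ft.
  have [||c] := @IVT R F k1 t 0 k1t.
  - apply: continuous_subspaceW cF; apply: subset_itvl; by rewrite bnd_simp.
  - by rewrite ge_min le_max Ft (ltW F1) orbT.
  - rewrite in_itv/= => /andP[k1c ct]; apply: F_neq0 => //.
    exact: le_trans tk2.
(* At a zero [c] of [A] in []s, t]], positivity of [F c] gives [D c > 0], whereas the Wronskian of
   [s] and [c] reduces to [- (A s * D c)], which would have to be positive. Once [A t > 0] is known,
   the Wronskian of [s] and [t] carries over the bound on the ratio. *)
have step s t : k1 <= s -> s < t -> t <= k2 -> t - s < d ->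
    0 < A s -> h * D s <= k1 * A s -> 0 < A t /\ h * D t <= k1 * A t.
  move=> k1s st tk2 tsd As Ds.
  suff At : 0 < A t.
    split => //; have := W s t k1s st tk2 tsd => Wst.
    have : h * (A s * D t) <= h * (D s * A t) by rewrite ler_pM2l//; lra.
    have := ler_wpM2r (ltW At) Ds.
    rewrite -(ler_pM2l As (h * D t)) => h1 h2; nra.
  rewrite ltNge; apply/negP => At.
  have [||c] := @IVT R A s t 0 (ltW st).
  - apply: continuous_subspaceW cA; apply: subset_itv; by rewrite bnd_simp.
  - by rewrite ge_min le_max At (ltW As) orbT.
  - rewrite in_itv/= => /andP[sc ct] Ac.
    have ck2 := le_trans ct tk2.
    have sc' : s < c.
      rewrite lt_neqAle sc andbT; apply/eqP => sE; move: As.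
      by rewrite sE Ac ltxx.
    have := F_gt0 c (le_trans k1s sc) ck2; rewrite /F Ac mulr0 addr0 pmulr_rgt0// => Dc.
    have csd : c - s < d by lra.
    have := W s c k1s sc' ck2 csd; rewrite Ac mulr0 sub0r oppr_gt0.
    by have := mulr_gt0 As Dc; lra.
(* Only parameters closer than [d] can be compared, so the bound travels from [k1] to [k2] in [N]
   equal steps, with [N] large enough to make them shorter than [d]. *)
set N := (Num.truncn ((k2 - k1) / d)).+1.
have N0 : 0 < N%:R :> R by rewrite ltr0n.
pose e := (k2 - k1) / N%:R.
have e0 : 0 < e by rewrite divr_gt0// subr_gt0.
have ed : e < d.
  rewrite /e ltr_pdivrMr// mulrC -ltr_pdivrMr//.
  by rewrite truncnS_gt// divr_ge0 ?ltW// subr_gt0.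
have Ne : k1 + N%:R * e = k2 by rewrite mulrC divfK ?gt_eqF//; ring.
have ind i : (i <= N)%N ->
    0 < A (k1 + i%:R * e) /\ h * D (k1 + i%:R * e) <= k1 * A (k1 + i%:R * e).
  elim: i => [_|i IH iN]; first by rewrite mul0r addr0 E1 lexx.
  have [Ai Di] := IH (ltnW iN).
  have iE : k1 + i.+1%:R * e = k1 + i%:R * e + e by rewrite -natr1; ring.
  apply: (step (k1 + i%:R * e)) => //; rewrite ?iE.
  - by rewrite lerDl mulr_ge0// ltW.
  - by rewrite ltrDl.
  - by rewrite -iE -Ne lerD2l ler_wpM2r ?(ltW e0)// ler_nat.
  - by rewrite addrC addKr.
have := ind N (leqnn _); rewrite Ne E2 => -[A2_gt0].
by rewrite ler_pM2r// leNgt k12.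
Qed.

(** The hypotheses are invariant under a change of sign of both [A] and [D], which reduces to
    [A k1 > 0]. The value 0 is impossible: it would force [D k1 = 0] and a vanishing Wronskian. *)
Lemma robin_crossing h k1 k2 d A D : 0 < h -> 0 < k1 -> k1 < k2 -> 0 < d ->
  {within `[k1, k2], continuous A} -> {within `[k1, k2], continuous D} ->
  (forall s t, k1 <= s -> s < t -> t <= k2 -> t - s < d ->
    0 < D s * A t - A s * D t) ->
  h * D k1 = k1 * A k1 -> h * D k2 = k2 * A k2 ->
  exists2 k, k \in `]k1, k2[ & h * D k + k * A k = 0.
Proof.
move=> h0 k10 k12 d0 cA cD W E1 E2.
have [A1|A1|A1] := ltgtP (A k1) 0; last 1 first.
- move: E1; rewrite A1 mulr0 => /eqP; rewrite mulf_eq0 gt_eqF//= => /eqP D1.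
  suff : 0 < D k1 * A (Num.min k2 (k1 + d / 2)) - A k1 * D (Num.min k2 (k1 + d / 2)).
    by rewrite A1 D1 !mul0r subrr ltxx.
  apply: W => //; first by rewrite lt_min k12/=; lra.
    by rewrite ge_min lexx.
  by rewrite ltrBlDr gt_min; apply/orP; right; lra.
- have [k kI] : exists2 k, k \in `]k1, k2[ & h * (- D) k + k * (- A) k = 0.
    apply: (@robin_crossing_pos h k1 k2 d) => //.
    + by move=> x; apply: cvgN; exact: cA.
    + by move=> x; apply: cvgN; exact: cD.
    + by move=> s t; rewrite !fctE !mulrNN; exact: W.
    + by rewrite !fctE !mulrN E1.
    + by rewrite !fctE !mulrN E2.
    + by rewrite !fctE oppr_gt0.
  rewrite !fctE => kE; exists k => //.
  by apply/eqP; rewrite -oppr_eq0 opprD -!mulrN kE.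
- exact: robin_crossing_pos W E1 E2 A1.
Qed.

End Crossing.

(** * Counting interlaced points *)

Lemma interlaced_card (R : realType) (P Q : R -> Prop) (I : interval R) n :
  (forall k1 k2, P k1 -> P k2 -> k1 < k2 -> exists2 k, k \in `]k1, k2[ & Q k) ->
  (`I_n #<= [set k | k \in I /\ P k])%card ->
  (`I_n.-1 #<= [set k | k \in I /\ Q k])%card.
Proof.
move=> PQ /pcard_leP[f].
(* Sorting the [n] points yields [n.-1] consecutive gaps, each containing a point of [Q]. Those
   points increase strictly, hence are distinct, and lie in [I] by convexity. *)
pose s := sort <=%R (map f (iota 0 n)).
have ss : sorted <%R s.
  rewrite sort_lt_sorted map_inj_in_uniq ?iota_uniq// => i j.
  by rewrite !mem_iota !add0n/= => iN jN; apply: (@inj _ _ _ f); rewrite inE.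
have szs : size s = n by rewrite size_sort size_map size_iota.
have sP i : (i < n)%N -> nth 0 s i \in I /\ P (nth 0 s i).
  move=> iN; have : nth 0 s i \in s by rewrite mem_nth// szs.
  rewrite mem_sort => /mapP[j]; rewrite mem_iota add0n/= => jN ->.
  exact: (@funS _ _ _ _ f j jN).
have lts i j : (i < n)%N -> (j < n)%N -> (nth 0 s i < nth 0 s j) = (i < j)%N.
  by move=> iN jN; rewrite (lt_sorted_ltn_nth 0 ss)// inE szs.
(* For [i.+1 >= n] there is no gap, and 0 is a default value; only indices below [n.-1] are used
   afterwards. *)
have /choice[g gP] : forall i, exists k : R, (i.+1 < n)%N ->
    (nth 0 s i < k < nth 0 s i.+1) /\ Q k.
  move=> i; have [iN|] := ltnP i.+1 n; last by exists 0.
  have [_ Pi] := sP i (ltnW iN); have [_ Pi1] := sP i.+1 iN.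
  have [|k kI Qk] := PQ _ _ Pi Pi1; first by rewrite lts// ltnW.
  by move: kI; rewrite in_itv/= => kI; exists k.
have lt_pred i : (i < n.-1)%N -> (i.+1 < n)%N by case: (n).
have gmono i j : (i < j)%N -> (j < n.-1)%N -> g i < g j.
  move=> ij jn; have jn' := lt_pred _ jn.
  have [] := gP i (lt_pred _ (ltn_trans ij jn)); move=> /andP[_ gi] _.
  have [] := gP j jn'; move=> /andP[gj _] _.
  apply: lt_trans gi _; apply: le_lt_trans gj.
  rewrite le_eqVlt lts ?ltnS//; last exact: ltnW.
    by move: ij; rewrite leq_eqVlt => /orP[/eqP ->|->]; rewrite ?eqxx// orbT.
  exact: leq_ltn_trans (ltnW jn').
have ginj : {in `I_n.-1 &, injective g}.
  move=> i j; rewrite !inE/= => iN jN gij.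
  have [ij|ij|//] := ltngtP i j.
    by have := gmono _ _ ij jN; rewrite gij ltxx.
  by have := gmono _ _ ij iN; rewrite gij ltxx.
rewrite -(card_le_eql (inj_card_eq ginj)); apply: subset_card_le.
move=> _ [i /= /lt_pred iN <-]; have [gi Qgi] := gP i iN; split => //.
have [si _] := sP i (ltnW iN); have [si1 _] := sP i.+1 iN.
apply: (interval_is_interval si si1).
by move: gi => /andP[/ltW -> /ltW ->].
Qed.

(** * Dependence on the spectral parameter *)

Definition neumann_solution (R : realType) (b : R) (q f df : R -> R) : Prop :=
  [/\ forall a, bmeas a b f, primitive_on b f df,
      primitive_on b df (fun t => q t * f t), f b = 1 & df b = 0].

Section NeumannSolutions.
Context {R : realType}.
Implicit Types (a b t k h M mu C D e : R) (f g q V : R -> R).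

Lemma apriori_with_derivative a b mu M D D0 f df q r :
  0 < mu -> M / mu / mu <= 2^-1 -> 0 <= D -> 0 <= D0 ->
  bmeas a b f -> bmeas a b q -> bmeas a b r ->
  (forall t, a <= t -> t <= b -> `|q t| <= M) ->
  (forall t, a <= t -> t <= b -> `|r t| <= D * expR (mu * (b - t))) ->
  primitive_on b f df -> primitive_on b df (fun t => q t * f t + r t) ->
  `|f b| <= D0 -> df b = 0 ->
  let C := 2 * (D0 + D / mu / mu) in
  forall t, a <= t -> t <= b ->
    `|f t| <= C * expR (mu * (b - t)) /\
    `|df t| <= (M * C + D) / mu * expR (mu * (b - t)).
Proof.
move=> mu0 Mmu D_0 D00 bf bq br qM rD pf pdf fb dfb C t at_ tb.
have fC := apriori mu0 Mmu D_0 bf bq br qM rD pf pdf fb dfb.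
split; first exact: fC.
have C0 : 0 <= C by rewrite mulr_ge0// addr_ge0// !divr_ge0// ltW.
by have [] := apriori_step mu0 D_0 C0 bf bq br qM rD pf pdf fb dfb fC at_ tb.
Qed.

Lemma weight_exists M : 0 <= M -> exists2 mu : R, 0 < mu & M / mu / mu <= 2^-1.
Proof.
move=> M0; exists (2 * (M + 1)); first lra.
by rewrite !ler_pdivrMr; [nra|lra|lra].
Qed.

(** With zero data at [b] and no forcing term, the a priori bound itself is zero. *)
Lemma solution_unique a b f df q : bmeas a b f -> bmeas a b q ->
  primitive_on b f df -> primitive_on b df (fun t => q t * f t) ->
  f b = 0 -> df b = 0 -> forall t, a <= t -> t <= b -> f t = 0.
Proof.
move=> bf bq pf pdf fb dfb t at_ tb.
case: (bq) => _ [M qM].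
have M0 : 0 <= M by exact: le_trans (qM _ at_ tb).
have [mu mu0 Mmu] := weight_exists M0.
have := @apriori R a b mu M 0 0 f df q (fun=> 0) mu0 Mmu (lexx 0) bf bq
  (bmeas_cst _ _ _) qM.
rewrite !mul0r addr0 mulr0 => h.
apply/eqP; rewrite -normr_le0 -(mul0r (expR (mu * (b - t)))).
apply: h => //.
- by move=> s _ _; rewrite mul0r normr0.
- by apply: eq_primitive pdf => s _; rewrite addr0.
- by rewrite fb normr0.
Qed.

Lemma neumann_solution_bound b mu M f df q :
  0 < mu -> M / mu / mu <= 2^-1 -> (forall a, bmeas a b q) ->
  (forall t, t <= b -> `|q t| <= M) -> neumann_solution b q f df ->
  forall t, t <= b ->
    `|f t| <= 2 * expR (mu * (b - t)) /\
    `|df t| <= M * 2 / mu * expR (mu * (b - t)).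
Proof.
move=> mu0 Mmu bq qM [bf pf pdf fb dfb] t tb.
have := @apriori_with_derivative t b mu M 0 1 f df q (fun=> 0) mu0 Mmu (lexx 0) ler01 (bf _)
  (bq _) (bmeas_cst _ _ _) (fun s _ => qM s).
rewrite /= !mul0r !addr0 mulr1 => h; apply: h => //.
- by move=> s _ _; rewrite mul0r normr0.
- by apply: eq_primitive pdf => s _; rewrite addr0.
- by rewrite fb normr1.
Qed.

(** [f - g] satisfies the equation of [f] with forcing term [(q - p) * g] and zero data at [b].
    Since [g] is at most twice the weight, the forcing has weighted size [2 * e], and the a priori
    estimate applies. *)
Lemma neumann_solution_dist b mu M e f df g dg q p :
  0 < mu -> M / mu / mu <= 2^-1 -> 0 <= e ->
  (forall a, bmeas a b q) -> (forall a, bmeas a b p) ->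
  (forall t, t <= b -> `|q t| <= M) -> (forall t, t <= b -> `|p t| <= M) ->
  (forall t, t <= b -> `|q t - p t| <= e) ->
  neumann_solution b q f df -> neumann_solution b p g dg ->
  let C := 2 * (2 * e / mu / mu) in
  forall t, t <= b ->
    `|f t - g t| <= C * expR (mu * (b - t)) /\
    `|df t - dg t| <= (M * C + 2 * e) / mu * expR (mu * (b - t)).
Proof.
move=> mu0 Mmu e0 bq bp qM pM qp sf sg C t tb.
have gC s : s <= b -> `|g s| <= 2 * expR (mu * (b - s)).
  by move=> sb; have [] := neumann_solution_bound mu0 Mmu bp pM sg sb.
case: sf sg => [bf pf pdf fb dfb] [bg pg pdg gb dgb].
have bqf a : bmeas a b (fun s => q s * f s) by exact: bmeasM.
have bpg a : bmeas a b (fun s => p s * g s) by exact: bmeasM.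
have bdf a : bmeas a b df by exact: primitive_bmeas (bqf a) pdf.
have bdg a : bmeas a b dg by exact: primitive_bmeas (bpg a) pdg.
have -> : C = 2 * (0 + 2 * e / mu / mu) by rewrite add0r.
apply: (@apriori_with_derivative t b mu M (2 * e) 0 (fun s => f s - g s)
  (fun s => df s - dg s) q (fun s => (q s - p s) * g s)) => //.
- by rewrite mulr_ge0.
- exact: bmeasB.
- by apply: bmeasM => //; exact: bmeasB.
- by move=> s _; exact: qM.
- move=> s _ sb; rewrite normrM (mulrC 2) -mulrA.
  by apply: ler_pM => //; [exact: qp|exact: gC].
- exact: primitiveB.
- apply: eq_primitive (primitiveB bqf bpg pdf pdg) => s _.
  by ring.
- by rewrite fb gb subrr normr0.
- by rewrite dfb dgb subrr.
Qed.

(** Integrating by parts in [df * g] and in [f * dg] produces the same term [df * dg], which cancels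
    in the difference. The Neumann condition removes the boundary terms at [b]. *)
Lemma wronskian a b d f df g dg q p : a <= b ->
  (forall a, bmeas a b q) -> (forall a, bmeas a b p) ->
  (forall t, t <= b -> p t - q t = d) ->
  neumann_solution b q f df -> neumann_solution b p g dg ->
  df a * g a - f a * dg a = d * integ a b (fun t => f t * g t).
Proof.
move=> ab bq bp pq [bf pf pdf fb dfb] [bg pg pdg gb dgb].
have bqf : bmeas a b (fun s => q s * f s) by exact: bmeasM.
have bpg : bmeas a b (fun s => p s * g s) by exact: bmeasM.
have bdf : bmeas a b df by exact: primitive_bmeas bqf pdf.
have bdg : bmeas a b dg by exact: primitive_bmeas bpg pdg.
have := integ_by_parts ab bqf bdg pdf pg.
have := integ_by_parts ab bdf bpg pf pdg.
rewrite dfb dgb mulr0 mul0r !sub0r => h1 h2.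
rewrite -integZ; last exact: bmeasM.
have -> : df a * g a - f a * dg a = - (f a * dg a) - - (df a * g a) by ring.
rewrite h1 h2 -integB; last 2 first.
- by apply: bmeasD; exact: bmeasM.
- by apply: bmeasD; exact: bmeasM.
by apply: eq_integ => s _ sb; rewrite -(pq s sb); ring.
Qed.

(** [e] depends only on [B], [L] and [C], which is what makes the step length uniform in the
    spectral parameter. Everywhere [f * g] is at least [f ^+ 2 - C * e], and [f >= 1/2] on a layer
    of width [eta] at [B]. *)
Lemma integ_mul_gt0 (B L C : R) : 0 < B -> 0 <= L -> 1 <= C ->
  exists2 e, 0 < e & forall f g, bmeas 0 B f -> bmeas 0 B g -> f B = 1 ->
    (forall t, 0 <= t -> t <= B -> `|f t| <= C) ->
    (forall t, 0 <= t -> t <= B -> `|f B - f t| <= L * (B - t)) ->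
    (forall t, 0 <= t -> t <= B -> `|f t - g t| <= e) ->
    0 < integ 0 B (fun t => f t * g t).
Proof.
move=> B0 L0 C1; have C0 : 0 < C by lra.
pose eta := Num.min B (2 * (L + 1))^-1.
have L1 : 0 < 2 * (L + 1) by lra.
have eta0 : 0 < eta by rewrite lt_min B0/= invr_gt0.
have etaB : eta <= B by rewrite ge_min lexx.
have Leta : L * eta <= 2^-1.
  have : eta <= (2 * (L + 1))^-1 by rewrite ge_min lexx orbT.
  move=> h; have := ler_wpM2l (ltW L1) h; rewrite mulfV ?gt_eqF//.
  by lra.
(* The layer contributes [eta / 4], and the total loss [C * e * B] is set to half of that. *)
pose e := eta / (8 * C * B).
have e0 : 0 < e by rewrite divr_gt0// !mulr_gt0.
have CeB : C * e * B = eta / 8.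
  by rewrite /e; field; rewrite !gt_eqF.
exists e => // f g bf bg fB fC fL fg.
have lower t : 0 <= t -> t <= B -> f t * f t - C * e <= f t * g t.
  move=> t0 tB; have := fC t t0 tB; have := fg t t0 tB => h1 h2.
  have : f t * (f t - g t) <= C * e.
    by apply: le_trans (ler_norm _) _; rewrite normrM; apply: ler_pM.
  by lra.
have Be0 : 0 <= B - eta by lra.
have BeB : B - eta <= B by lra.
have bfg : bmeas 0 B (fun t => f t * g t) by exact: bmeasM.
rewrite (integ_split Be0 BeB)//.
have h1 : - (C * e) * (B - eta - 0) <= integ 0 (B - eta) (fun t => f t * g t).
  rewrite -integ_cst//; apply: le_integ; first exact: bmeas_cst.
    exact: bmeasS bfg.
  move=> t t0 tB; have := lower t t0 (le_trans tB BeB).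
  by have := sqr_ge0 (f t); rewrite expr2; lra.
have h2 : (4^-1 - C * e) * (B - (B - eta)) <=
    integ (B - eta) B (fun t => f t * g t).
  rewrite -integ_cst//; apply: le_integ; first exact: bmeas_cst.
    exact: bmeasS bfg.
  move=> t tB' tB; have t0 := le_trans Be0 tB'.
  apply: le_trans (lower t t0 tB); rewrite lerD2r.
  have := fL t t0 tB; rewrite fB ler_norml => /andP[_ h].
  have : L * (B - t) <= L * eta by rewrite ler_wpM2l//; lra.
  move=> h3; have f2 : 2^-1 <= f t by lra.
  have -> : 4^-1 = 2^-1 * 2^-1 :> R by field.
  by apply: ler_pM.
apply: lt_le_trans (lerD h1 h2).
have -> : - (C * e) * (B - eta - 0) + (4^-1 - C * e) * (B - (B - eta)) =
  eta / 4 - C * e * B by ring.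
by rewrite CeB; lra.
Qed.

End NeumannSolutions.

(** * Resonances on the imaginary axis *)

Section Resonance.
Context {R : realType}.
Implicit Types (a b c x y t k h B C kappa : R) (f g q V F G v : R -> R).

Lemma eq_integ_ae b x y f g : y <= b ->
  measurable_fun `[x, y] f -> measurable_fun `[x, y] g ->
  {ae (@lebesgue_measure R), forall t, t <= b -> f t = g t} ->
  integ x y f = integ x y g.
Proof.
move=> yb mf mg fg; rewrite /Rintegral; congr fine; apply: ae_eq_integral => //.
- exact/measurable_EFinP.
- exact/measurable_EFinP.
- move: fg; apply: filterS; first exact: (ae_filter_ringOfSetsType (@lebesgue_measure R)).
  move=> t fg; rewrite /= in_itv/= => /andP[_ ty].
  by rewrite fg// (le_trans ty).
Qed.

Lemma L2loc_bmeas B f : (forall a, bmeas a B f) -> L2loc B f.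
Proof.
move=> bf a aB; split; first by case: (bf a).
apply: (@bmeas_integrable _ _ _ (fun x => f x ^+ 2)).
by apply: eq_bmeas (bmeasM (bf a) (bf a)) => t _ _; rewrite expr2.
Qed.

Lemma L2loc_integrable B f a : L2loc B f -> a < B ->
  (@lebesgue_measure R).-integrable `[a, B] (EFin \o f).
Proof.
move=> Lf aB; have [mf If] := Lf a aB.
pose g x : R := 1 + f x ^+ 2.
apply: (@le_integrable _ _ R (@lebesgue_measure R) `[a, B] _ (EFin \o f) (EFin \o g)) => //.
- exact/measurable_EFinP.
- move=> x _; rewrite /g /= lee_fin.
  rewrite (@ger0_norm _ (1 + _)); last by rewrite addr_ge0// sqr_ge0.
  rewrite ler_norml; apply/andP; split; nra.
- have := integrableD (mu := @lebesgue_measure R) (D := `[a, B]) (measurable_itv _)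
    (bmeas_integrable (bmeas_cst a B 1)) If.
  by [].
Qed.

(** This brings a resonant state, known only to be in H^2_loc, into the class [bmeas]: its
    derivative vanishes at [B] and is therefore bounded on compact sets by the integral of
    [|ddf|]. *)
Lemma L2loc_primitive_bmeas B df ddf : L2loc B df -> L2loc B ddf ->
  primitive_on B df ddf -> df B = 0 -> forall a, bmeas a B df.
Proof.
move=> Ldf Lddf pdf dfB a.
(* [L2loc] speaks only of left end points strictly below [B], while [a] is arbitrary. *)
pose a' := Num.min a (B - 1).
have a'B : a' < B by rewrite gt_min; apply/orP; right; lra.
apply: (@bmeasS _ a' B) => //; first by rewrite ge_min lexx.
split; first by case: (Ldf a' a'B).
exists (integ a' B (fun t => `|ddf t|)) => t a't tB.
have Iddf := L2loc_integrable Lddf a'B.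
have := pdf t B tB (lexx B); rewrite dfB sub0r => /eqP.
rewrite eqr_oppLR => /eqP ->; rewrite normrN.
have sub : `[t, B] `<=` `[a', B] by apply: subset_itv; rewrite bnd_simp.
apply: le_trans (le_normr_Rintegral _ _) _ => //.
  exact: integrableS Iddf.
rewrite [leRHS](integ_split_integrable a't tB); last first.
  exact: (integrable_norm Iddf).
by rewrite lerDr; apply: Rintegral_ge0.
Qed.

Lemma lipschitz_eq0_left F C :
  (forall x, -1 <= x -> x < 0 -> `|F x| <= C * - x) ->
  (forall x, -1 <= x -> x <= 0 -> `|F 0 - F x| <= C * - x) -> F 0 = 0.
Proof.
move=> F0 FC; apply/eqP; rewrite -normr_le0; apply: (@le0_archi _ _ (C + C)) => n.
have n0 : 0 < n.+1%:R :> R by rewrite ltr0n.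
have h1 : -1 <= - (n.+1%:R^-1) :> R.
  by rewrite lerN2 invf_le1// ler1n.
have h2 : - (n.+1%:R^-1) < 0 :> R by rewrite oppr_lt0 invr_gt0.
rewrite -ler_pdivlMr//.
have := FC _ h1 (ltW h2); have := F0 _ h1 h2; rewrite opprK => hx hd.
rewrite -(subrK (F (- n.+1%:R^-1)) (F 0)); apply: le_trans (ler_normD _ _) _.
by rewrite mulrDl; exact: lerD.
Qed.

(** The outgoing form of a state is prescribed for x < 0 only, while the Robin condition is read at
    0. Applied to the difference of a state and an exponential, this carries both values to 0 by
    continuity. *)
Lemma primitive_eq0_left F f g : bmeas (-1) 0 g -> bmeas (-1) 0 f ->
  primitive_on 0 F f -> primitive_on 0 f g -> (forall x, x < 0 -> F x = 0) ->
  F 0 = 0 /\ f 0 = 0.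
Proof.
move=> bg bf pF pf Fx0.
have [_ [M fM]] := bf; have [_ [N gN]] := bg.
have M0 : 0 <= M by apply: le_trans (fM 0 _ _) => //; rewrite oppr_le0.
have N0 : 0 <= N by apply: le_trans (gN 0 _ _) => //; rewrite oppr_le0.
have F0 : F 0 = 0.
  apply: (@lipschitz_eq0_left _ M) => x x1 x0.
    by rewrite Fx0// normr0 mulr_ge0// oppr_ge0 ltW.
  by have := primitive_lipschitz bf fM pF x1 x0 (lexx 0); rewrite sub0r.
split=> //; apply: (@lipschitz_eq0_left _ N) => x x1 x0; last first.
  by have := primitive_lipschitz bg gN pf x1 x0 (lexx 0); rewrite sub0r.
(* [f] has mean zero on [[x, 0]]; comparison with the constant [f x], [f] being [N]-Lipschitz, gives
   [|f x| <= N * - x]. *)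
have Ix : integ x 0 f = 0 by rewrite -pF ?(ltW x0)// F0 Fx0// subrr.
have bfx : bmeas x 0 f by exact: bmeasS bf.
have : `|integ x 0 (fun t => f t - f x)| <= N * - x * (0 - x).
  apply: ler_norm_integ_cst; first exact: ltW.
    by apply: bmeasB => //; exact: bmeas_cst.
  move=> t xt t0.
  apply: le_trans (primitive_lipschitz bg gN pf x1 xt t0) _.
  by rewrite ler_wpM2l//; lra.
rewrite integB//; last exact: bmeas_cst.
rewrite Ix integ_cst ?(ltW x0)// !sub0r normrN normrM (@ger0_norm _ (- x)).
  by rewrite ler_pM2r// oppr_gt0.
by rewrite oppr_ge0 ltW.
Qed.

Section ImaginaryResonance.
Local Open Scope complex_scope.

Lemma complexVr x : (x%:C)^-1 = (x^-1)%:C :> R[i].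
Proof. by rewrite [RHS]fmorphV. Qed.

Lemma outgoing_exponent kappa x h :
  (0 -i* 1) * (0 +i* kappa) * x%:C / h%:C = (kappa * x / h)%:C :> R[i].
Proof.
rewrite complexVr; apply/eqP; rewrite eq_complex/=.
by apply/andP; split; apply/eqP; ring.
Qed.

Lemma cexp_real x : cexp x%:C = (expR x)%:C :> R[i].
Proof. by rewrite /cexp /= cos0 sin0 -[_ +i* _]/(1%:C) mulr1. Qed.

Lemma schrodinger_re_im h V kappa (u ddu : R -> R[i]) x : 0 < h ->
  - (h ^+ 2)%:C * ddu x + (V x)%:C * u x - (0 +i* kappa) ^+ 2 * u x = 0 ->
  complex.Re (ddu x) = (V x + kappa ^+ 2) / h ^+ 2 * complex.Re (u x) /\
  complex.Im (ddu x) = (V x + kappa ^+ 2) / h ^+ 2 * complex.Im (u x).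
Proof.
move=> h0; case: (ddu x) => c d; case: (u x) => a b.
have h2 : h ^+ 2 != 0 by rewrite expf_neq0// gt_eqF.
rewrite expr2 => /eqP; rewrite eq_complex/= => /andP[/eqP e1 /eqP e2].
by split; apply: (mulfI h2); rewrite mulrA mulrCA divff// mulr1; lra.
Qed.

(** On the imaginary axis both the equation and the outgoing exponential are real, so the real and
    imaginary parts of a state satisfy all the conditions separately; one of them is nonzero at
    [x0]. *)
Lemma resonance_real B h V kappa : 0 < h ->
  resonance B h V (0 +i* kappa) ->
  exists v dv ddv, [/\ H2loc B v dv ddv, exists2 x, x <= B & v x <> 0,
    {ae (@lebesgue_measure R), forall x, x <= B ->
      ddv x = (V x + kappa ^+ 2) / h ^+ 2 * v x},
    dv B = 0 &
    exists a, forall x, x < 0 -> v x = a * expR (kappa * x / h)].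
Proof.
move=> h0 [u [du [ddu [[Hre Him] [x0 x0B ux0] eqn duB [alpha ualpha]]]]].
have [re0|/eqP re0] := eqVneq (complex.Re (u x0)) 0; last first.
  exists (fun x => complex.Re (u x)), (fun x => complex.Re (du x)),
    (fun x => complex.Re (ddu x)); split => //.
  - by exists x0.
  - move: eqn; apply: filterS; first exact: (ae_filter_ringOfSetsType (@lebesgue_measure R)).
  move=> x eqn /eqn e.
    by case: (schrodinger_re_im h0 e).
  - by rewrite duB.
  - exists (complex.Re alpha) => x /ualpha ->.
    by rewrite outgoing_exponent cexp_real; case: alpha {ualpha} => ? ? /=; ring.
exists (fun x => complex.Im (u x)), (fun x => complex.Im (du x)),
  (fun x => complex.Im (ddu x)); split => //.
- exists x0 => // im0; apply: ux0; apply/eqP; rewrite eq_complex/= re0 im0.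
  by rewrite eqxx.
- move: eqn; apply: filterS; first exact: (ae_filter_ringOfSetsType (@lebesgue_measure R)).
  move=> x eqn /eqn e.
  by case: (schrodinger_re_im h0 e).
- by rewrite duB.
- exists (complex.Im alpha) => x /ualpha ->.
  by rewrite outgoing_exponent cexp_real; case: alpha {ualpha} => ? ? /=; ring.
Qed.

Lemma H2loc0 B : H2loc B (fun=> 0 : R) (fun=> 0) (fun=> 0).
Proof.
have L0 : L2loc B (fun=> 0 : R) by apply: L2loc_bmeas => a; exact: bmeas_cst.
by split => // x y xy yB; rewrite subrr integ_cst// mul0r.
Qed.

Lemma real_resonance B h V kappa v dv ddv : 0 < h -> H2loc B v dv ddv ->
  (exists2 x, x <= B & v x <> 0) ->
  (forall x, x <= B -> ddv x = (V x + kappa ^+ 2) / h ^+ 2 * v x) ->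
  dv B = 0 ->
  (exists a, forall x, x < 0 -> v x = a * expR (kappa * x / h)) ->
  resonance B h V (0 +i* kappa).
Proof.
move=> h0 Hv [x0 x0B vx0] eqn dvB [a va].
exists (fun x => (v x)%:C), (fun x => (dv x)%:C), (fun x => (ddv x)%:C).
split.
- by split => //=; exact: H2loc0.
- by exists x0 => //; move=> /eqP; rewrite eq_complex/= => /andP[/eqP].
- apply: aeW => x xB; rewrite eqn//; apply/eqP; rewrite expr2 eq_complex/=.
  apply/andP; split; apply/eqP; last by ring.
  by field; rewrite gt_eqF.
- by rewrite dvB.
- exists a%:C => x /va ->.
  by rewrite outgoing_exponent cexp_real rmorphM.
Qed.

(** [kappa] may have either sign, so this covers bound and antibound states alike. The Neumann
    condition makes any state a multiple of [f], and the outgoing condition says that [f] continues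
    to the left of 0 as a pure exponential of rate [kappa / h]. *)
Lemma resonance_imagP B h V kappa f df :
  0 < B -> 0 < h -> (forall a, bmeas a B V) -> (forall x, x < 0 -> V x = 0) ->
  neumann_solution B (fun t => (V t + kappa ^+ 2) / h ^+ 2) f df ->
  resonance B h V (0 +i* kappa) <-> h * df 0 = kappa * f 0.
Proof.
move=> B0 h0 bV V0; set q := fun t => _; move=> [bf pf pdf fB dfB].
have bq a : bmeas a B q.
  apply: (@eq_bmeas _ _ _ (fun t => (h ^+ 2)^-1 * (V t + kappa ^+ 2))).
    by move=> t _ _; rewrite mulrC.
  by apply: bmeasZ; apply: bmeasD => //; exact: bmeas_cst.
have bqf a : bmeas a B (fun t => q t * f t) by exact: bmeasM.
have bdf a : bmeas a B df by exact: primitive_bmeas (bqf a) pdf.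
have B0' := ltW B0.
pose c := kappa / h.
(* [E k x] is k exp(kappa x / h), written in the shape of [primitive_expR]; differentiation
   multiplies the coefficient [k] by [c]. *)
pose E k x := k * expR (- c * (0 - x)).
have bE k a b : bmeas a b (E k)
  by exact: (bmeasZ _ (bmeas_expR _ _ _ _)).
have pE k b : primitive_on b (E k) (E (c * k)).
  have := primitiveZ k _ (@primitive_expR R b (- c) 0).
  rewrite opprK => /(_ _)/eq_primitive; apply.
    by move=> t _; rewrite /E; ring.
  by move=> a; exact: (bmeasZ _ (bmeas_expR _ _ _ _)).
have EE k x : E k x = k * expR (kappa * x / h).
  by rewrite /E; congr (_ * expR _); rewrite /c; ring.
split.
- move=> /(resonance_real h0)[v [dv [ddv [[Lv Ldv Lddv pv pdv] [x0 x0B vx0] eqn dvB [a va]]]]].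
  have bdv := L2loc_primitive_bmeas Ldv Lddv pdv dvB.
  have bv a' : bmeas a' B v by exact: primitive_bmeas (bdv a') pv.
  have bqv a' : bmeas a' B (fun t => q t * v t) by exact: bmeasM.
  have pdv' : primitive_on B dv (fun t => q t * v t).
    move=> x y xy yB; rewrite pdv//.
    have mS g : (forall a, measurable_fun `[a, B] g) -> measurable_fun `[x, y] g.
      move=> mg; apply: measurable_funS (mg x) => //.
      by apply: subset_itv; rewrite bnd_simp.
    apply: (@eq_integ_ae B) => //; last by apply: mS => a'; case: (bqv a').
    (* [x] may equal [B], so measurability is taken on a larger segment. *)
    have [mddv _] := Lddv (x - 1) ltac:(lra).
    apply: measurable_funS mddv => //.
    by apply: subset_itv; rewrite bnd_simp//; lra.
  (* [v] and [v B * f] solve the same equation with the same data at [B]. In particular [v B] cannot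
     vanish, as [v] is nonzero somewhere. *)
  have vE t : t <= B -> v t = v B * f t.
    move=> tB; apply/eqP; rewrite -subr_eq0; apply/eqP.
    have bvBf a' : bmeas a' B (fun t => v B * f t) by exact: bmeasZ.
    have bvBqf a' : bmeas a' B (fun t => v B * (q t * f t)) by exact: bmeasZ.
    have bvBdf a' : bmeas a' B (fun t => v B * df t) by exact: bmeasZ.
    apply: (@solution_unique R t B (fun t => v t - v B * f t)
      (fun t => dv t - v B * df t) q) => //.
    + exact: bmeasB.
    + by apply: primitiveB => //; exact: primitiveZ.
    + apply: eq_primitive (primitiveB bqv bvBqf pdv' (primitiveZ _ bqf pdf)).
      by move=> s _; ring.
    + by rewrite fB mulr1 subrr.
    + by rewrite dvB dfB mulr0 subrr.
  have vB0 : v B != 0.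
    by apply/eqP => vB; apply: vx0; rewrite vE// vB mul0r.
  have fE x : x < 0 -> f x = E (a / v B) x.
    move=> x0'; have xB : x <= B by lra.
    have := vE x xB; rewrite va// EE => e.
    by apply: (mulfI vB0); rewrite -e; field.
  set k := a / v B in fE.
  have bf0 a' : bmeas a' 0 f by exact: bmeasS (bf a').
  have bdf0 a' : bmeas a' 0 df by exact: bmeasS (bdf a').
  have bqf0 a' : bmeas a' 0 (fun t => q t * f t) by exact: bmeasS (bqf a').
  have [] := @primitive_eq0_left (fun x => f x - E k x)
    (fun x => df x - E (c * k) x) (fun x => q x * f x - E (c * (c * k)) x).
  + exact: bmeasB.
  + exact: bmeasB.
  + by apply: primitiveB => //; exact: primitive_le pf.
  + by apply: primitiveB => //; exact: primitive_le pdf.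
  + by move=> x /fE ->; rewrite subrr.
  rewrite !EE mulr0 mul0r expR0 !mulr1 => /eqP; rewrite subr_eq0 => /eqP ->.
  move=> /eqP; rewrite subr_eq0 => /eqP ->.
  by rewrite /c; field; rewrite gt_eqF.
- move=> bc; have df0 : df 0 = c * f 0.
    by apply: (mulfI (lt0r_neq0 h0)); rewrite bc /c; field; rewrite gt_eqF.
  apply: (@real_resonance _ _ _ _ f df (fun t => q t * f t)) => //.
  + by split => //; apply: L2loc_bmeas.
  + by exists B => //; rewrite fB; apply/eqP; exact: oner_neq0.
  exists (f 0) => x x0; rewrite -EE; apply/eqP; rewrite -subr_eq0; apply/eqP.
  have bf0 a' : bmeas a' 0 f by exact: bmeasS (bf a').
  have bdf0 a' : bmeas a' 0 df by exact: bmeasS (bdf a').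
  have bq0 a' : bmeas a' 0 q by exact: bmeasS (bq a').
  have bqf0 a' : bmeas a' 0 (fun t => q t * f t) by exact: bmeasM.
  apply: (@solution_unique R x 0 (fun t => f t - E (f 0) t)
    (fun t => df t - E (c * f 0) t) q) => //; last exact: ltW.
  + exact: bmeasB.
  + by apply: primitiveB => //; exact: primitive_le pf.
  + have p2 := primitiveB bqf0 (fun a => bE (c * (c * f 0)) a 0)
      (primitive_le B0' pdf) (pE (c * f 0) 0).
    move=> y z yz z0; rewrite p2//; apply: (@eq_integ_ae 0) => //.
    * have [+ _] : bmeas y 0 (fun t => q t * f t - E (c * (c * f 0)) t).
        exact: bmeasB.
      by apply: measurable_funS => //; apply: subset_itv; rewrite bnd_simp.
    * have [+ _] : bmeas y 0 (fun t => q t * (f t - E (f 0) t)).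
        by apply: bmeasM => //; exact: bmeasB.
      by apply: measurable_funS => //; apply: subset_itv; rewrite bnd_simp.
    (* The potential is known to vanish only for t < 0, so the two integrands may differ at 0, which
       is a null set. *)
    * exists [set 0]; split => //; first exact: lebesgue_measure_set1.
      move=> t /=; apply: contra_notP => /eqP t0 t_le0.
      rewrite /q V0; last by rewrite lt_neqAle t0.
      by rewrite /E /c; field; rewrite gt_eqF.
  + by rewrite EE mulr0 mul0r expR0 mulr1 subrr.
  + by rewrite EE mulr0 mul0r expR0 mulr1 df0 subrr.
Qed.

End ImaginaryResonance.
End Resonance.

(** * Uniform constants on [k1, k2] and the crossing between two bound states *)

Lemma antibound_between (R : realType) (B h k1 k2 N : R) (V : R -> R) :
  0 < B -> 0 < h -> (forall a, bmeas a B V) ->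
  (forall t, t <= B -> `|V t| <= N) -> (forall t, t < 0 -> V t = 0) ->
  bound_state B h V k1 -> bound_state B h V k2 -> k1 < k2 ->
  exists2 k, k \in `]k1, k2[ & antibound_state B h V k.
Proof.
move=> B0 h0 bV VN V0 [k10 res1] [k20 res2] k12.
have B0' := ltW B0; have h20 : 0 < h ^+ 2 by rewrite exprn_gt0.
pose q k t := (V t + k ^+ 2) / h ^+ 2.
have bq k a : bmeas a B (q k).
  apply: (@eq_bmeas _ _ _ (fun t => (h ^+ 2)^-1 * (V t + k ^+ 2))).
    by move=> t _ _; rewrite mulrC.
  by apply: bmeasZ; apply: bmeasD => //; exact: bmeas_cst.
pose M := (N + k2 ^+ 2) / h ^+ 2.
have qM k t : k1 <= k -> k <= k2 -> t <= B -> `|q k t| <= M.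
  move=> k1k kk2 tB; rewrite normrM [X in _ * X]gtr0_norm ?invr_gt0//.
  rewrite ler_wpM2r ?invr_ge0 ?(ltW h20)//; apply: le_trans (ler_normD _ _) _.
  apply: lerD; first exact: VN.
  rewrite ger0_norm ?sqr_ge0// ler_sqr ?nnegrE//; lra.
have [sol solP] : {sol : R -> (R -> R) * (R -> R) &
    forall k, neumann_solution B (q k) (sol k).1 (sol k).2}.
  apply: (@choice _ _ (fun k s => neumann_solution B (q k) s.1 s.2)) => k.
  have qk t : t <= B -> `|q k t| <= (N + k ^+ 2) / h ^+ 2.
    move=> tB; rewrite normrM [X in _ * X]gtr0_norm ?invr_gt0//.
    rewrite ler_wpM2r ?invr_ge0 ?(ltW h20)//; apply: le_trans (ler_normD _ _) _.
    by rewrite (ger0_norm (sqr_ge0 k)) lerD2r; exact: VN.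
  by have [f [df fP]] := neumann_solution_exists (bq k) qk; exists (f, df).
pose A k := (sol k).1 0; pose D k := (sol k).2 0.
(* Only the square of [kappa] enters the equation, so [sol k] serves both [kappa = k] and
   [kappa = - k]. *)
have resP kappa k : kappa ^+ 2 = k ^+ 2 ->
    resonance B h V (Complex 0 kappa) <-> h * D k = kappa * A k.
  move=> kk; apply: resonance_imagP => //.
  by rewrite kk; exact: solP.
have M0 : 0 <= M.
  by apply: le_trans (qM k1 B (lexx _) (ltW k12) (lexx _)).
have [mu mu0 Mmu] := weight_exists M0.
pose W := expR (mu * (B - 0)).
have W1 : 1 <= W by exact: weight_ge1.
have wW t : 0 <= t -> expR (mu * (B - t)) <= W.
  by move=> t0; rewrite ler_expR ler_wpM2l ?(ltW mu0)// lerD2l lerN2.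
(* [L] is a Lipschitz constant of [k |-> q k] on [k1, k2], because t + s <= 2 k2. [K] and [K'] are
   the resulting weighted constants for the solution and its derivative. *)
pose L := 2 * k2 / h ^+ 2.
have L0 : 0 <= L by rewrite divr_ge0 ?(ltW h20)// mulr_ge0// ltW.
pose K := 2 * (2 * L / mu / mu).
have K0 : 0 <= K by rewrite mulr_ge0// !divr_ge0 ?(ltW mu0)// mulr_ge0.
pose K' := (M * K + 2 * L) / mu.
have K'0 : 0 <= K' by rewrite divr_ge0 ?(ltW mu0)// addr_ge0// mulr_ge0.
have dist s t x : k1 <= s -> s <= t -> t <= k2 -> 0 <= x -> x <= B ->
    `|(sol s).1 x - (sol t).1 x| <= K * W * (t - s) /\
    `|(sol s).2 x - (sol t).2 x| <= K' * W * (t - s).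
  move=> k1s st tk2 x0 xB.
  have ts0 : 0 <= t - s by lra.
  have Lts : 0 <= L * (t - s) by rewrite mulr_ge0.
  have qst y : y <= B -> `|q s y - q t y| <= L * (t - s).
    move=> _; have -> : q s y - q t y = - ((t + s) * (t - s) / h ^+ 2).
      by rewrite /q; field; rewrite gt_eqF.
    rewrite normrN ger0_norm; last first.
      by rewrite divr_ge0 ?(ltW h20)// mulr_ge0//; lra.
    rewrite [leRHS]mulrAC ler_wpM2r ?invr_ge0 ?(ltW h20)//.
    by rewrite ler_wpM2r//; lra.
  have [h1 h2] := neumann_solution_dist mu0 Mmu Lts (bq s) (bq t)
    (fun y => qM s y k1s (le_trans st tk2))
    (fun y => qM t y (le_trans k1s st) tk2) qst (solP s) (solP t) xB.
  split.
    apply: le_trans h1 _.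
    have -> : 2 * (2 * (L * (t - s)) / mu / mu) = K * (t - s) by rewrite /K; ring.
    by rewrite mulrAC ler_wpM2r// ler_wpM2l// wW.
  apply: le_trans h2 _.
  have -> : (M * (2 * (2 * (L * (t - s)) / mu / mu)) + 2 * (L * (t - s))) / mu =
      K' * (t - s) by rewrite /K' /K; ring.
  by rewrite mulrAC ler_wpM2r// ler_wpM2l// wW.
have Mmu0 : 0 <= M * 2 / mu by rewrite divr_ge0 ?(ltW mu0)// mulr_ge0.
have MW0 : 0 <= M * 2 / mu * W by rewrite mulr_ge0// expR_ge0.
(* On [0, B] the weight is at most [W], so [neumann_solution_bound] gives the bound [2 * W] for
   every solution and the Lipschitz constant [M * 2 / mu * W], uniformly in k. *)
have [|e e0 pos] := @integ_mul_gt0 R B (M * 2 / mu * W) (2 * W) B0 MW0; first lra.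
have KW0 : 0 <= K * W by rewrite mulr_ge0// expR_ge0.
(* Parameters closer than [e / (K * W + 1)] have solutions within [e] of each other on [0, B]; the
   added 1 makes the divisor positive. *)
have [|||s t k1s st tk2 ts|||k kI kE] :=
    @robin_crossing R h k1 k2 (e / (K * W + 1)) A D h0 k10 k12.
- by rewrite divr_gt0//; lra.
- apply: (@lipschitz_within_continuous _ _ _ _ (K * W)) => s t k1s st tk2.
  by rewrite distrC; have [] := dist s t 0 k1s st tk2 (lexx 0) B0'.
- apply: (@lipschitz_within_continuous _ _ _ _ (K' * W)) => s t k1s st tk2.
  by rewrite distrC; have [] := dist s t 0 k1s st tk2 (lexx 0) B0'.
- have qts x : x <= B -> q t x - q s x = (t + s) * (t - s) / h ^+ 2.
    by move=> _; rewrite /q; field; rewrite gt_eqF.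
  rewrite /A /D (wronskian B0' (bq s) (bq t) qts (solP s) (solP t)).
  have sb := neumann_solution_bound mu0 Mmu (bq s)
    (fun y => qM s y k1s (le_trans (ltW st) tk2)) (solP s).
  have := solP s; have := solP t => -[bg _ _ _ _] [bf pf pdf fB _].
  apply: mulr_gt0.
    by rewrite divr_gt0// mulr_gt0//; lra.
  apply: pos => //.
  + move=> x x0 xB; have [h1 _] := sb x xB; apply: le_trans h1 _.
    by rewrite ler_wpM2l// wW.
  + move=> x x0 xB.
    have bdf : bmeas 0 B (sol s).2.
      by apply: primitive_bmeas pdf; exact: bmeasM.
    apply: (primitive_lipschitz bdf _ pf) => // y y0 yB.
    have [_ h1] := sb y yB; apply: le_trans h1 _.
    by rewrite ler_wpM2l// wW.
  + move=> x x0 xB; have [h1 _] := dist s t x k1s (ltW st) tk2 x0 xB.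
    apply: le_trans h1 _.
    have KW1 : 0 < K * W + 1 by lra.
    have : (t - s) * (K * W + 1) <= e by rewrite -ler_pdivlMr// ltW.
    by lra.
- exact/(resP k1 k1).
- exact/(resP k2 k2).
exists k => //; split.
  by move: kI; rewrite in_itv/= => /andP[+ _]; exact: lt_trans.
apply/(resP (- k) k); first by rewrite sqrrN.
by lra.
Qed.

Theorem theorem2 (R : realType) (B h : R) (V : R -> R)
  (B_gt0 : 0 < B) (h_gt0 : 0 < h)
  (V_meas : measurable_fun `]-oo, B] V)
  (V_bounded : [bounded V x | x in `]-oo, B]])
  (V_supp : forall x, x <= B -> V x != 0 -> x \in `[0, B]) :
  (forall k1 k2 : R,
     bound_state B h V k1 -> bound_state B h V k2 -> k1 < k2 ->
     exists2 k, k \in `]k1, k2[ & antibound_state B h V k)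
  /\
  (forall (I : interval R) (n : nat),
     [set` I] `<=` `]0, +oo[ -> (1 <= n)%N ->
     (`I_n #<= [set k | k \in I /\ bound_state B h V k])%card ->
     (`I_n.-1 #<= [set k | k \in I /\ antibound_state B h V k])%card).
Proof.
have [N VN] : exists N, forall t, t <= B -> `|V t| <= N.
  (* Boundedness is stated for every constant strictly above [N], hence [N + 1]. *)
  case: V_bounded => N [_ VN]; exists (N + 1) => t tB.
  by apply: VN; rewrite ?ltrDl//= in_itv.
have bV a : bmeas a B V.
  split; last by exists N => t _; exact: VN.
  by apply: measurable_funS V_meas => //; apply: subset_itv; rewrite bnd_simp.
have V0 t : t < 0 -> V t = 0.
  move=> t0; apply/eqP; apply: contraTT t0 => Vt.
  have [tB|Bt] := leP t B.
    by have := V_supp t tB Vt; rewrite in_itv/= leNgt => /andP[].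
  by rewrite -leNgt ltW// (lt_trans B_gt0).
have btw k1 k2 := @antibound_between R B h k1 k2 N V B_gt0 h_gt0 bV VN V0.
by split => // I n _ _; exact: interlaced_card.
Qed.
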